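(* Consider the following two formulations of the stochastic bin packing problem on empty machines. (A) (UCaC minimization) $$\min_{x}\ \sum_{i=1}^{N} D(\alpha)\sqrt{\sum_{j=1}^{K} x_{i,j}b_j}$$ subject to $\sum_{j=1}^{K}x_{i,j}\mu_j + D(\alpha)\sqrt{\sum_{j=1}^{K}x_{i,j}b_j}\le V$ for all $i\in[N]$, $\sum_{i=1}^{N}x_{i,j}=m_j$ for all $j\in[K]$, and each $x_{i,j}$ a non-negative integer. (B) (Minimization of the number of used machines) $$\min_{x,y}\ \sum_{i=1}^{N} y_i$$ subject to $\sum_{j=1}^{K}\mu_j x_{i,j} + D(\alpha)\sqrt{\sum_{j=1}^{K}b_j x_{i,j}}\le V y_i$ for all $i\in[N]$, $\sum_{i=1}^{N}x_{i,j}=m_j$ for all $j\in[K]$, each $x_{i,j}$ a non-negative integer, and each $y_i\in\{0,1\}$. The optimal solution of (A), which minimizes UCaC on empty machines, uses at most $\frac{8}{3}N^*$ machines, where $N^*$ is the optimal number of used machines obtained by solving (B).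
   Context: $[n]$ denotes $\{1,\dots,n\}$. There are $N$ machines, each of capacity $V$, all initially empty (hosting no containers), and $K$ services; service $j$ requests $m_j$ containers, whose resource usages are independent and identically distributed random variables with mean $\mu_j$ and uncertainty metric $b_j$ (e.g. the variance, for Gaussian usage). The variable $x_{i,j}$ is the number of containers of service $j$ placed on machine $i$, and $y_i$ denotes whether or not machine $i$ is used; a machine is used if at least one container is placed on it. $\alpha\in(0,1]$ is the confidence level with which the total resource usage on a machine is required not to exceed its capacity, and $D(\alpha)$ is a constant depending on $\alpha$ (for Gaussian usage, the $\alpha$-quantile of the standard normal distribution). The UCaC (Used Capacity at Confidence) of a machine at confidence level $\alpha$ is the minimum $U$ such that the total resource usage of its containers is at most $U$ with probability at least $\alpha$; in the formulations here the UCaC of machine $i$ is expressed as $\sum_{j=1}^{K} x_{i,j}\mu_j + D(\alpha)\sqrt{\sum_{j=1}^{K} x_{i,j}b_j}$. The UCaC of a cluster is the sum of the UCaC of all its machines. Since $\sum_{i}\sum_{j} x_{i,j}\mu_j=\sum_j m_j\mu_j$ is constant on feasible points, minimizing the cluster UCaC is equivalent to minimizing the objective of (A).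
   Formalization: The formal theorem additionally assumes D(α) > 0, every mean μ_j ≥ 0 and every b_j > 0; without these the claim fails (for D(α) ≤ 0 or b_j = 0 spreading containers over all machines can be optimal for (A); for μ_j < 0 one can have N* = 0). *)

(* Defs.v *)
From HB Require Import structures.
From mathcomp Require Import all_boot all_order all_algebra.

Set Implicit Arguments.
Unset Strict Implicit.
Unset Printing Implicit Defensive.

Import Order.TTheory GRing.Theory Num.Theory.
Local Open Scope ring_scope.

Section StochasticBinPacking.

Variables (R : rcfType) (N K : nat).
(* [d] is the value D(alpha) of the confidence constant. *)
Variables (V d : R) (mu b : 'I_K -> R) (m : 'I_K -> nat).

(* [x i j] is the number of containers of service [j] on machine [i]. *)
Implicit Types (x : 'M[nat]_(N, K)) (y : 'I_N -> bool).

Definition uncertainty x (i : 'I_N) : R :=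
  d * Num.sqrt (\sum_(j < K) (x i j)%:R * b j).

Definition ucac x (i : 'I_N) : R :=
  \sum_(j < K) (x i j)%:R * mu j + uncertainty x i.

Definition all_placed x : Prop :=
  forall j : 'I_K, (\sum_(i < N) x i j)%N = m j.

Definition ucac_feasible x : Prop :=
  (forall i : 'I_N, ucac x i <= V) /\ all_placed x.

Definition ucac_objective x : R := \sum_(i < N) uncertainty x i.

Definition ucac_optimal x : Prop :=
  ucac_feasible x /\
  forall x', ucac_feasible x' -> ucac_objective x <= ucac_objective x'.

Definition machines_feasible x y : Prop :=
  (forall i : 'I_N, ucac x i <= V * (y i)%:R) /\ all_placed x.

Definition machines_objective y : nat := (\sum_(i < N) y i)%N.

Definition machines_optimal x y : Prop :=
  machines_feasible x y /\
  forall x' y', machines_feasible x' y' ->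
    (machines_objective y <= machines_objective y')%N.

Definition used_machines x : nat :=
  #|[set i : 'I_N | [exists j : 'I_K, (0 < x i j)%N]]|.

End StochasticBinPacking.

(* Main.v *)
Require Import Defs.
From HB Require Import structures.
From mathcomp Require Import all_boot all_order all_algebra.
From mathcomp Require Import lra.

Set Implicit Arguments.
Unset Strict Implicit.
Unset Printing Implicit Defensive.

Import Order.TTheory GRing.Theory Num.Theory.
Local Open Scope ring_scope.

(** The total mean usage is the same for every placement of all containers, so
    a placement minimizing the objective of (A) also minimizes the total UCaC.
    Hence its total UCaC is at most that of the placement solving (B), which is
    at most [V] times the number [N*] of machines that (B) switches on
    ([sum_ucac_optimal_le]).

    Conversely, the optimal placement of (A) cannot leave its machines too
    empty. The square root is strictly subadditive on positive reals, so pouring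
    one used machine into another one strictly decreases the objective; by
    optimality the result must overflow. Thus any two used machines have
    together a UCaC larger than [V] ([ucac_optimal_pair]), and averaging over
    the [n] used machines, when [n >= 2], gives a total UCaC of at least
    [n V / 2] ([card_mul_le_sum_pairwise]). Comparing the two bounds yields
    [n <= 2 N*], which is stronger than the ratio 8/3; the case [n = 1] only
    needs [N* >= 1], since a total UCaC that is positive requires some machine
    to be switched on. *)

Lemma sqrtr_ltD (R : rcfType) (s t : R) : 0 < s -> 0 < t ->
  Num.sqrt (s + t) < Num.sqrt s + Num.sqrt t.
Proof.
move=> s0 t0; have qs0 : 0 < Num.sqrt s by rewrite sqrtr_gt0.
have qt0 : 0 < Num.sqrt t by rewrite sqrtr_gt0.
have q0 : 0 < Num.sqrt s + Num.sqrt t by lra.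
rewrite -[ltRHS](ger0_norm (ltW q0)) -sqrtr_sqr ltr_sqrt ?exprn_gt0 //.
rewrite sqrrD !sqr_sqrtr ?ltW //.
have : 0 < Num.sqrt s * Num.sqrt t by apply: mulr_gt0.
lra.
Qed.

Lemma card_mul_le_sum_pairwise (R : realFieldType) (I : finType) (S : {set I})
    (F : I -> R) (V : R) :
  {in S &, forall i k, i != k -> V <= F i + F k} -> (1 < #|S|)%N ->
  #|S|%:R * V <= 2%:R * \sum_(i in S) F i.
Proof.
move=> pairV S_gt1.
have half_sum (T : {set I}) : {in T, forall i, V <= 2%:R * F i} ->
    #|T|%:R * V <= 2%:R * \sum_(i in T) F i.
  by move=> TV; rewrite mulr_natl -sumr_const mulr_sumr; apply: ler_sum.
have [/existsP[i /andP[iS iV]]|no_small] :=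
    boolP [exists i, (i \in S) && (2%:R * F i < V)]; last first.
  apply: half_sum => i iS; rewrite leNgt; apply: contra no_small => iV.
  by apply/existsP; exists i; rewrite iS.
(* An element below V/2 is compensated by a partner; all others exceed V/2. *)
have /card_gt0P[k kSi] : (0 < #|S :\ i|)%N by move: S_gt1; rewrite (cardsD1 i) iS.
have /setD1P[k_i kS] := kSi.
have rest : #|S :\ i :\ k|%:R * V <= 2%:R * \sum_(l in S :\ i :\ k) F l.
  apply: half_sum => l /setD1P[_ /setD1P[l_i lS]].
  have := pairV _ _ iS lS; rewrite eq_sym => /(_ l_i); lra.
have := pairV _ _ kS iS k_i.
rewrite (cardsD1 i S) iS (cardsD1 k) kSi !natrD.
rewrite (big_setD1 i iS) (big_setD1 k kSi) /=; lra.
Qed.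

Section Placements.

Variables (R : rcfType) (N K : nat) (V d : R) (mu b : 'I_K -> R).
Variable m : 'I_K -> nat.
Hypotheses (d_gt0 : 0 < d) (mu_ge0 : forall j, 0 <= mu j).
Hypothesis b_gt0 : forall j, 0 < b j.
Implicit Types (x : 'M[nat]_(N, K)) (c : 'I_K -> R) (i k l : 'I_N).

Definition load c x i : R := \sum_(j < K) (x i j)%:R * c j.

Definition used x i : bool := [exists j : 'I_K, (0 < x i j)%N].

Lemma uncertaintyE x i : uncertainty d b x i = d * Num.sqrt (load b x i).
Proof. by []. Qed.

Lemma ucacE x i : ucac d mu b x i = load mu x i + uncertainty d b x i.
Proof. by []. Qed.

Lemma load_ge0 c x i : (forall j, 0 <= c j) -> 0 <= load c x i.
Proof. by move=> c0; apply: sumr_ge0 => j _; rewrite mulr_ge0 ?ler0n. Qed.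

Lemma load_gt0 x i : used x i -> 0 < load b x i.
Proof.
case/existsP => j xj; rewrite /load (bigD1 j) //= ltr_pwDl //.
  by rewrite mulr_gt0 ?ltr0n.
by apply: sumr_ge0 => k _; rewrite mulr_ge0 ?ler0n ?ltW.
Qed.

Lemma ucac_ge0 x i : 0 <= ucac d mu b x i.
Proof.
by rewrite ucacE addr_ge0 ?load_ge0 // uncertaintyE mulr_ge0 ?sqrtr_ge0 ?ltW.
Qed.

Lemma ucac_gt0 x i : used x i -> 0 < ucac d mu b x i.
Proof.
move=> /load_gt0 bi; rewrite ucacE ltr_wpDl ?load_ge0 // uncertaintyE.
by rewrite mulr_gt0 ?sqrtr_gt0.
Qed.

Definition merge x i k : 'M[nat]_(N, K) :=
  \matrix_(l, j) if l == i then (x i j + x k j)%N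
                 else if l == k then 0%N else x l j.

Lemma load_merge c x i k l : load c (merge x i k) l =
  if l == i then load c x i + load c x k
  else if l == k then 0 else load c x l.
Proof.
rewrite /load; case: ifPn => [li|li]; [|case: ifPn => lk].
- by rewrite -big_split; apply: eq_bigr => j _; rewrite mxE li natrD mulrDl.
- by rewrite big1 // => j _; rewrite mxE (negPf li) lk mul0r.
- by apply: eq_bigr => j _; rewrite mxE (negPf li) (negPf lk).
Qed.

Lemma all_placed_merge x i k : i != k ->
  all_placed m x -> all_placed m (merge x i k).
Proof.
move=> ik xm j; rewrite -(xm j).
rewrite (bigD1 i) // (bigD1 k) 1?eq_sym //= [in RHS](bigD1 i) //.
rewrite [in RHS](bigD1 k) 1?eq_sym //= !mxE eqxx.
rewrite eq_sym (negPf ik) eqxx add0n -addnA; congr (_ + (_ + _))%N.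
by apply: eq_bigr => l /andP[li lk]; rewrite mxE (negPf li) (negPf lk).
Qed.

(** Only the terms of the two merged machines change in the objective, and
    there strict subadditivity of the square root applies. *)
Lemma ucac_objective_merge x i k : i != k -> used x i -> used x k ->
  ucac_objective d b (merge x i k) < ucac_objective d b x.
Proof.
move=> ik iU kU; rewrite /ucac_objective.
rewrite (bigD1 i) // (bigD1 k) 1?eq_sym //= [in ltRHS](bigD1 i) //.
rewrite [in ltRHS](bigD1 k) 1?eq_sym //= !addrA.
rewrite (eq_bigr (uncertainty d b x)); last first.
  by move=> l /andP[/negPf li /negPf lk]; rewrite !uncertaintyE load_merge li lk.
rewrite ltrD2r !uncertaintyE !load_merge eqxx eq_sym (negPf ik) eqxx.
by rewrite sqrtr0 mulr0 addr0 -mulrDr ltr_pM2l // sqrtr_ltD ?load_gt0.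
Qed.

Lemma ucac_feasible_merge x i k : 0 <= V -> i != k -> used x i -> used x k ->
  ucac d mu b x i + ucac d mu b x k <= V ->
  ucac_feasible V d mu b m x -> ucac_feasible V d mu b m (merge x i k).
Proof.
move=> V0 ik iU kU ikV [xV xm]; split; last exact: all_placed_merge.
move=> l; have := xV l; rewrite !ucacE !uncertaintyE !load_merge.
case: ifPn => _ => [_|]; last by case: ifPn => // _ _; rewrite sqrtr0 mulr0 addr0.
have := sqrtr_ltD (load_gt0 iU) (load_gt0 kU); rewrite -(ltr_pM2l d_gt0).
by move: ikV; rewrite !ucacE !uncertaintyE; lra.
Qed.

Lemma ucac_optimal_pair x i k : ucac_optimal V d mu b m x -> i != k ->
  used x i -> used x k -> V < ucac d mu b x i + ucac d mu b x k.
Proof.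
move=> [xF x_min] ik iU kU; rewrite ltNge; apply/negP => ikV.
have V0 : 0 <= V by apply: le_trans (xF.1 i); apply: ucac_ge0.
have := x_min _ (ucac_feasible_merge V0 ik iU kU ikV xF).
by rewrite leNgt ucac_objective_merge.
Qed.

Lemma sum_ucacE x : all_placed m x ->
  \sum_i ucac d mu b x i = \sum_j (m j)%:R * mu j + ucac_objective d b x.
Proof.
move=> xm; rewrite (eq_bigr _ (fun i _ => ucacE x i)) big_split; congr (_ + _).
rewrite exchange_big; apply: eq_bigr => j _.
by rewrite -(xm j) natr_sum mulr_suml.
Qed.

Lemma sum_ucac_optimal_le x x' y : 0 <= V -> ucac_optimal V d mu b m x ->
  machines_feasible V d mu b m x' y ->
  \sum_i ucac d mu b x i <= V * (machines_objective y)%:R.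
Proof.
move=> V0 [[_ xm] x_min] [x'V x'm].
have x'F : ucac_feasible V d mu b m x'.
  split=> // i; apply: le_trans (x'V i) _.
  by case: (y i); rewrite ?mulr1 ?mulr0.
apply: (@le_trans _ _ (\sum_i ucac d mu b x' i)).
  by rewrite !sum_ucacE // lerD2l x_min.
by rewrite /machines_objective natr_sum mulr_sumr ler_sum.
Qed.

Lemma used_machines_le_double x x' y : ucac_optimal V d mu b m x ->
  machines_feasible V d mu b m x' y ->
  (used_machines x <= 2 * machines_objective y)%N.
Proof.
move=> x_opt yF; rewrite /used_machines; set S := [set i | _].
have SE i : (i \in S) = used x i by rewrite inE.
have [->|[i iS]] := set_0Vmem S; first by rewrite cards0.
have Ui : 0 < ucac d mu b x i by rewrite ucac_gt0 -?SE.
have V0 : 0 < V by apply: lt_le_trans Ui (x_opt.1.1 i).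
have W_le := sum_ucac_optimal_le (ltW V0) x_opt yF.
have S_le_W : \sum_(l in S) ucac d mu b x l <= \sum_l ucac d mu b x l.
  by rewrite big_mkcond ler_sum // => l _; case: ifP => // _; apply: ucac_ge0.
have [S_gt1|S_le1] := ltnP 1 #|S|.
  have SV : #|S|%:R * V <= 2%:R * \sum_(l in S) ucac d mu b x l.
    apply: card_mul_le_sum_pairwise => // l k; rewrite !SE => lU kU lk.
    exact/ltW/ucac_optimal_pair.
  rewrite -(ler_nat R) -(ler_pM2r V0) natrM; lra.
apply: leq_trans S_le1 _; rewrite muln_gt0 /= -(ltr0n R) -(pmulr_rgt0 _ V0).
apply: lt_le_trans W_le; apply: lt_le_trans S_le_W.
rewrite (big_setD1 i iS) /= ltr_pwDl // sumr_ge0 // => l _; exact: ucac_ge0.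
Qed.

End Placements.

Theorem theorem5 (R : rcfType) (N K : nat) (V : R) (mu b : 'I_K -> R)
    (m : 'I_K -> nat) (alpha : R) (D : R -> R)
    (alpha_gt0 : 0 < alpha) (alpha_le1 : alpha <= 1) (D_gt0 : 0 < D alpha)
    (mu_ge0 : forall j, 0 <= mu j) (b_gt0 : forall j, 0 < b j)
    (x xstar : 'M[nat]_(N, K)) (ystar : 'I_N -> bool)
    (x_opt : ucac_optimal V (D alpha) mu b m x)
    (star_opt : machines_optimal V (D alpha) mu b m xstar ystar) :
  (used_machines x)%:R <= 8%:R / 3%:R * (machines_objective ystar)%:R :> R.
Proof.
have := used_machines_le_double D_gt0 mu_ge0 b_gt0 x_opt star_opt.1.
rewrite -(ler_nat R) natrM; have := ler0n R (machines_objective ystar); lra.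
Qed.
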